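(* Let $f(q)=\sum_{n\in\mathbb{N}}q^na_n$, with $a_n\in\mathbb{H}$, have radius of convergence $R>0$ and let $p\in B(0,R)=\{q\in\mathbb{H}:|q|<R\}$. Then $$f(q)=\sum_{n\in\mathbb{N}}(q-p)^{*n}f^{(n)}(p)\frac{1}{n!}$$ for all $q\in\Sigma(p,R-|p|)=\{q\in\mathbb{H}:\sigma(q,p)<R-|p|\}$.
   Context: $\mathbb{H}$ is the skew field of real quaternions, with real part $Re(q)$, imaginary part $Im(q)$ and Euclidean modulus $|q|$. Let $\mathbb{S}=\{q\in\mathbb{H}:q^2=-1\}$ and, for $I\in\mathbb{S}$, $L_I=\mathbb{R}+I\mathbb{R}$ (a ''complex line''). The radius of convergence $R\in[0,+\infty]$ of $\sum_n q^na_n$ is given by $1/R=\limsup_{n\to\infty}|a_n|^{1/n}$. For $p,q\in\mathbb{H}$ put $\omega(q,p)=\sqrt{[Re(q)-Re(p)]^2+[|Im(q)|+|Im(p)|]^2}$, and let $\sigma(q,p)=|q-p|$ if $p,q$ lie in a common complex line $L_I$, and $\sigma(q,p)=\omega(q,p)$ otherwise. The regular multiplication $*$ of polynomials/power series with right coefficients is $\left(\sum_n q^n a_n\right)*\left(\sum_n q^n b_n\right)=\sum_n q^n\sum_{k=0}^n a_kb_{n-k}$, and $(q-p)^{*n}$ is the $n$-th power of $q-p$ with respect to $*$ (with $(q-p)^{*0}=1$), evaluated at $q$. The (formal) derivative of $f(q)=\sum_n q^na_n$ is $f'(q)=\sum_n q^na_{n+1}(n+1)$, which has the same radius of convergence,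 and $f^{(n)}$ denotes the $n$-th iterated derivative. *)

(* Defs.v *)
From HB Require Import structures.
From mathcomp Require Import all_boot all_order all_algebra.
From mathcomp Require Import all_classical all_reals all_analysis.
From mathcomp Require Import ring lra.

Set Implicit Arguments.
Unset Strict Implicit.
Unset Printing Implicit Defensive.

Import Order.TTheory GRing.Theory Num.Theory.
Import numFieldNormedType.Exports.

Local Open Scope classical_set_scope.
Local Open Scope ring_scope.

(* [Quat a b c d] is the quaternion a + b i + c j + d k. *)
Record quat (R : realType) :=
  Quat { quat0 : R; quat1 : R; quat2 : R; quat3 : R }.

Section QuaternionAlgebra.
Variable R : realType.
Implicit Types (x y z : quat R) (l : R).

Lemma quat_eq x y : quat0 x = quat0 y -> quat1 x = quat1 y ->
  quat2 x = quat2 y -> quat3 x = quat3 y -> x = y.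
Proof. by case: x y => [????] [????] /= -> -> -> ->. Qed.

Definition prod_of_quat x := (quat0 x, quat1 x, quat2 x, quat3 x).
Definition quat_of_prod (t : R * R * R * R) : quat R :=
  Quat t.1.1.1 t.1.1.2 t.1.2 t.2.

Lemma prod_of_quatK : cancel prod_of_quat quat_of_prod.
Proof. by case. Qed.

HB.instance Definition _ := Choice.copy (quat R) (can_type prod_of_quatK).

Definition quat_zero : quat R := Quat 0 0 0 0.
Definition quat_opp x : quat R :=
  Quat (- quat0 x) (- quat1 x) (- quat2 x) (- quat3 x).
Definition quat_add x y : quat R :=
  Quat (quat0 x + quat0 y) (quat1 x + quat1 y)
       (quat2 x + quat2 y) (quat3 x + quat3 y).

Fact quat_addA : associative quat_add.
Proof. by move=> x y z; apply: quat_eq => /=; rewrite addrA. Qed.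
Fact quat_addC : commutative quat_add.
Proof. by move=> x y; apply: quat_eq => /=; rewrite addrC. Qed.
Fact quat_add0 : left_id quat_zero quat_add.
Proof. by move=> x; apply: quat_eq => /=; rewrite add0r. Qed.
Fact quat_addN : left_inverse quat_zero quat_opp quat_add.
Proof. by move=> x; apply: quat_eq => /=; rewrite addNr. Qed.

HB.instance Definition _ := GRing.isZmodule.Build (quat R)
  quat_addA quat_addC quat_add0 quat_addN.

Definition quat_one : quat R := Quat 1 0 0 0.
Definition quat_mul x y : quat R :=
  let: Quat a b c d := x in
  let: Quat a' b' c' d' := y in
  Quat (a * a' - b * b' - c * c' - d * d')
       (a * b' + b * a' + c * d' - d * c')
       (a * c' - b * d' + c * a' + d * b')
       (a * d' + b * c' - c * b' + d * a').

Fact quat_mulA : associative quat_mul.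
Proof. by move=> [????] [????] [????]; apply: quat_eq => /=; ring. Qed.
Fact quat_mul1l : left_id quat_one quat_mul.
Proof. by move=> [????]; apply: quat_eq => /=; ring. Qed.
Fact quat_mul1r : right_id quat_one quat_mul.
Proof. by move=> [????]; apply: quat_eq => /=; ring. Qed.
Fact quat_mulDl : left_distributive quat_mul quat_add.
Proof. by move=> [????] [????] [????]; apply: quat_eq => /=; ring. Qed.
Fact quat_mulDr : right_distributive quat_mul quat_add.
Proof. by move=> [????] [????] [????]; apply: quat_eq => /=; ring. Qed.
Fact quat_one_neq0 : quat_one != quat_zero.
Proof. by apply/eqP => -[] /eqP; rewrite oner_eq0. Qed.

HB.instance Definition _ := GRing.Zmodule_isNzRing.Build (quat R)
  quat_mulA quat_mul1l quat_mul1r quat_mulDl quat_mulDr quat_one_neq0.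

Definition quat_scale l x : quat R :=
  Quat (l * quat0 x) (l * quat1 x) (l * quat2 x) (l * quat3 x).

Fact quat_scaleA l l' x : quat_scale l (quat_scale l' x) = quat_scale (l * l') x.
Proof. by apply: quat_eq => /=; rewrite mulrA. Qed.
Fact quat_scale1 : left_id 1 quat_scale.
Proof. by move=> x; apply: quat_eq => /=; rewrite mul1r. Qed.
Fact quat_scaleDr : right_distributive quat_scale +%R.
Proof. by move=> l x y; apply: quat_eq => /=; rewrite mulrDr. Qed.
Fact quat_scaleDl x : {morph quat_scale^~ x : l l' / l + l'}.
Proof. by move=> l l'; apply: quat_eq => /=; rewrite mulrDl. Qed.

HB.instance Definition _ := GRing.Zmodule_isLmodule.Build R (quat R)
  quat_scaleA quat_scale1 quat_scaleDr quat_scaleDl.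

Fact quat_scaleAl l x y : l *: (x * y) = (l *: x) * y.
Proof. by case: x y => [????] [????]; apply: quat_eq => /=; ring. Qed.
Fact quat_scaleAr l x y : l *: (x * y) = x * (l *: y).
Proof. by case: x y => [????] [????]; apply: quat_eq => /=; ring. Qed.

HB.instance Definition _ := GRing.Lmodule_isLalgebra.Build R (quat R)
  quat_scaleAl.
HB.instance Definition _ := GRing.Lalgebra_isAlgebra.Build R (quat R)
  quat_scaleAr.

Definition quat_sqnorm x : R :=
  quat0 x ^+ 2 + quat1 x ^+ 2 + quat2 x ^+ 2 + quat3 x ^+ 2.
Definition quat_norm x : R := Num.sqrt (quat_sqnorm x).

Fact quat_sqnorm_ge0 x : 0 <= quat_sqnorm x.
Proof. by rewrite /quat_sqnorm !addr_ge0 ?sqr_ge0. Qed.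

Fact quat_normD x y : quat_norm (x + y) <= quat_norm x + quat_norm y.
Proof.
have nx := sqrtr_ge0 (quat_sqnorm x); have ny := sqrtr_ge0 (quat_sqnorm y).
rewrite -[leRHS]ger0_norm ?addr_ge0// -sqrtr_sqr ler_wsqrtr//.
rewrite sqrrD !sqr_sqrtr ?quat_sqnorm_ge0// -sqrtrM ?quat_sqnorm_ge0//.
pose s := quat0 x * quat0 y + quat1 x * quat1 y +
  quat2 x * quat2 y + quat3 x * quat3 y.
suff CS : s <= Num.sqrt (quat_sqnorm x * quat_sqnorm y).
  rewrite [leLHS](_ : _ = quat_sqnorm x + s *+ 2 + quat_sqnorm y).
    by rewrite lerD2r lerD2l lerMn2r.
  by rewrite /s /quat_sqnorm /=; ring.
apply: (le_trans (ler_norm s)); rewrite -sqrtr_sqr ler_wsqrtr// -subr_ge0.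
rewrite [leRHS](_ : _ =
  (quat0 x * quat1 y - quat1 x * quat0 y) ^+ 2 +
  (quat0 x * quat2 y - quat2 x * quat0 y) ^+ 2 +
  (quat0 x * quat3 y - quat3 x * quat0 y) ^+ 2 +
  (quat1 x * quat2 y - quat2 x * quat1 y) ^+ 2 +
  (quat1 x * quat3 y - quat3 x * quat1 y) ^+ 2 +
  (quat2 x * quat3 y - quat3 x * quat2 y) ^+ 2).
  by rewrite !addr_ge0 ?sqr_ge0.
by rewrite /s /quat_sqnorm; ring.
Qed.

Fact quat_normZ l x : quat_norm (l *: x) = `|l| * quat_norm x.
Proof.
rewrite -sqrtr_sqr -sqrtrM ?sqr_ge0//; congr Num.sqrt.
by rewrite /quat_sqnorm /=; ring.
Qed.

Fact quat_norm0_eq0 x : quat_norm x = 0 -> x = 0.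
Proof.
move/eqP; rewrite sqrtr_eq0 /quat_sqnorm => x0.
have := sqr_ge0 (quat0 x); have := sqr_ge0 (quat1 x).
have := sqr_ge0 (quat2 x); have := sqr_ge0 (quat3 x) => h3 h2 h1 h0.
by apply: quat_eq; apply/eqP; rewrite -sqrf_eq0; apply/eqP => /=; lra.
Qed.

HB.instance Definition _ := Lmodule_isNormed.Build R (quat R)
  quat_normD quat_normZ quat_norm0_eq0.

Lemma quat_normE x : `|x| =
  Num.sqrt (quat0 x ^+ 2 + quat1 x ^+ 2 + quat2 x ^+ 2 + quat3 x ^+ 2).
Proof. by []. Qed.

Definition quatRe x : R := quat0 x.
Definition quatIm x : quat R := Quat 0 (quat1 x) (quat2 x) (quat3 x).

End QuaternionAlgebra.

Section PowerSeries.
Variable R : realType.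
Implicit Types (p q I : quat R) (a : (quat R)^nat).

Definition imag_sphere : set (quat R) := [set I | I ^+ 2 = -1].

Definition cplx_line I : set (quat R) :=
  [set q | exists x y : R, q = x%:A + y *: I].

Definition quat_omega q p : R :=
  Num.sqrt ((quatRe q - quatRe p) ^+ 2 + (`|quatIm q| + `|quatIm p|) ^+ 2).

Definition common_line q p : Prop :=
  exists2 I, imag_sphere I & cplx_line I q /\ cplx_line I p.

Definition quat_sigma q p : R :=
  if `[< common_line q p >] then `|q - p| else quat_omega q p.

Definition Sigma_ball p (r : \bar R) : set (quat R) :=
  [set q | ((quat_sigma q p)%:E < r)%E].

(* In \bar R, 0^-1 = +oo and +oo^-1 = 0. *)
Definition conv_radius a : \bar R :=
  ((limn_esup (fun n => (`|a n| `^ n%:R^-1)%:E))^-1)%E.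

(* Coefficients are written on the right; since [quat R] is not commutative,
   [p.[q]] of the library, which evaluates \sum_i p`_i * q ^+ i, is not
   suitable here. *)
Definition qpseries_at a q : (quat R)^nat := series (fun n => q ^+ n * a n).

(* Junk value (the default point) when the series diverges at q. *)
Definition qpseries a q : quat R := limn (qpseries_at a q).

Definition poly_at (P : {poly quat R}) q : quat R :=
  \sum_(i < size P) q ^+ i * P`_i.

(* The product of {poly quat R} is the regular product * : by [coefM],
   (P * Q)`_n = \sum_(k < n.+1) P`_k * Q`_(n - k), the indeterminate being
   central.  Hence ('X - p%:P) ^+ n is the regular power of q - p. *)
Definition regular_pow p n q : quat R := poly_at (('X - p%:P) ^+ n) q.

Definition dcoef a : (quat R)^nat := fun n => a n.+1 *+ n.+1.

Definition qpseries_deriv a n q : quat R := qpseries (iter n dcoef a) q.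

End PowerSeries.

(* Main.v *)
(* The regular powers satisfy [P_(n+1) = q P_n - P_n p], and the operator
   [w |-> q w - w p] has norm at most omega(q, p); when p and q commute,
   [P_n = (q - p)^n].  Hence |(q - p)^{*n}| <= sigma(q, p)^n.  As p commutes
   with X - p, the binomial formula in H[X] expands q^m in the regular powers:
   q^m a_m = \sum_n P_n p^(m - n) C(m, n) a_m.  This double family is summable
   because \sum_m (sigma + |p|)^m |a_m| converges, and summing over m first
   produces the Taylor coefficients of f at p. *)
Require Import Defs.
From HB Require Import structures.
From mathcomp Require Import all_boot all_order all_algebra.
From mathcomp Require Import all_classical all_reals all_analysis.
From mathcomp Require Import ring.

Import Order.TTheory GRing.Theory Num.Theory.
Import numFieldNormedType.Exports.

Local Open Scope classical_set_scope.
Local Open Scope ring_scope.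

Set Implicit Arguments.
Unset Strict Implicit.
Unset Printing Implicit Defensive.

(** The bound [y] will be a radius of convergence, possibly [+oo], while geometric comparison needs
    a real radius strictly below it. *)
Lemma lte_dense_fin (R : realFieldType) (x : R) (y : \bar R) : (x%:E < y)%E ->
  exists2 r : R, x < r & (r%:E < y)%E.
Proof.
case: y => [y| |//] => [|_]; last by exists (x + 1); rewrite ?ltry// ltrDl.
by rewrite lte_fin => xy; exists ((x + y) / 2); rewrite ?lte_fin midf_lt.
Qed.

(** * The quaternion norm and the commutator bound *)

Section QuatNorm.
Variable R : realType.
Implicit Types x y w p q : quat R.

Lemma sqr_quat_norm x : `|x| ^+ 2 = quat_sqnorm x.
Proof. by rewrite sqr_sqrtr// quat_sqnorm_ge0. Qed.

(** After squaring, this is Euler's four-square identity. *)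
Lemma quat_normM x y : `|x * y| = `|x| * `|y|.
Proof.
apply/eqP; rewrite -(@eqrXn2 _ 2)// ?mulr_ge0// exprMn !sqr_quat_norm.
by case: x y => [????] [????]; apply/eqP; rewrite /quat_sqnorm /=; ring.
Qed.

Lemma quat_norm1 : `|1 : quat R| = 1.
Proof. by rewrite quat_normE /= expr1n !expr0n /= !addr0 sqrtr1. Qed.

Lemma quat_normX x n : `|x ^+ n| = `|x| ^+ n.
Proof.
elim: n => [|n IHn]; first by rewrite !expr0 quat_norm1.
by rewrite !exprS quat_normM IHn.
Qed.

(* Writing [q w - w p = (Re q - Re p) w + (Im q w - w Im p)], the second
   summand is orthogonal to [w]. *)
Lemma quat_norm_commutator_le q p w : `|q * w - w * p| <= quat_omega q p * `|w|.
Proof.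
pose v := quatIm q * w - w * quatIm p.
have -> : q * w - w * p = (quatRe q - quatRe p) *: w + v.
  by rewrite /v; case: q p w @v => [????] [????] [????];
    apply: quat_eq => /=; ring.
have v_le : `|v| ^+ 2 <= (`|quatIm q| + `|quatIm p|) ^+ 2 * `|w| ^+ 2.
  rewrite -exprMn ler_pXn2r// ?nnegrE ?mulr_ge0 ?addr_ge0//.
  rewrite (le_trans (ler_normB _ _))// !quat_normM mulrDl.
  by rewrite (mulrC `|w|).
rewrite -(@ler_pXn2r _ 2) ?nnegrE ?mulr_ge0 ?sqrtr_ge0//.
rewrite exprMn [quat_omega q p ^+ 2]sqr_sqrtr ?addr_ge0 ?sqr_ge0//.
rewrite mulrDl (le_trans _ (lerD (lexx _) v_le))// !sqr_quat_norm.
rewrite /v /quat_sqnorm; case: q p w {v v_le} => [????] [????] [????] /=.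
(* Pythagoras: the cross term vanishes, so what remains is an equality. *)
by rewrite le_eqVlt; apply/orP; left; apply/eqP; ring.
Qed.

Lemma common_line_comm q p : common_line q p -> q * p = p * q.
Proof.
move=> [I _ [[x [y ->]] [u [v ->]]]].
rewrite !mulrDl !mulrDr -!scalerAl -!scalerAr !mul1r !mulr1.
rewrite !scalerA (mulrC x) (mulrC y v) (mulrC x v) (mulrC y u) -!addrA.
by congr (_ + _); rewrite addrCA.
Qed.

Lemma quat_sigma_ge0 q p : 0 <= quat_sigma q p.
Proof. by rewrite /quat_sigma; case: ifP => _; rewrite ?sqrtr_ge0. Qed.

End QuatNorm.

(** * Evaluation of polynomials and regular powers *)

Section RegularPowers.
Variable R : realType.
Implicit Types (P Q : {poly quat R}) (p q c : quat R).

Lemma poly_at_widen P q n : (size P <= n)%N ->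
  poly_at P q = \sum_(i < n) q ^+ i * P`_i.
Proof.
move=> Pn; rewrite /poly_at (big_ord_widen _ (fun i => q ^+ i * P`_i) Pn).
rewrite big_mkcond; apply: eq_bigr => i _; case: ltnP => // Pi.
by rewrite nth_default ?mulr0.
Qed.

Lemma poly_at0 q : poly_at 0 q = 0.
Proof. by rewrite /poly_at size_poly0 big_ord0. Qed.

Lemma poly_at1 q : poly_at 1 q = 1.
Proof. by rewrite /poly_at size_poly1 big_ord1 coef1 mulr1. Qed.

Lemma poly_atD P Q q : poly_at (P + Q) q = poly_at P q + poly_at Q q.
Proof.
pose n := maxn (size P) (size Q).
rewrite !(@poly_at_widen _ _ n) ?leq_maxl ?leq_maxr ?size_polyD//.
by rewrite -big_split; apply: eq_bigr => i _; rewrite coefD mulrDr.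
Qed.

Lemma poly_atN P q : poly_at (- P) q = - poly_at P q.
Proof. by apply/eqP; rewrite -addr_eq0 -poly_atD addNr poly_at0. Qed.

Lemma poly_atMn P q n : poly_at (P *+ n) q = poly_at P q *+ n.
Proof.
by elim: n => [|n IHn]; rewrite ?mulr0n ?poly_at0// !mulrS poly_atD IHn.
Qed.

Lemma poly_at_sum (I : Type) (r : seq I) (F : I -> {poly quat R}) q :
  poly_at (\sum_(i <- r) F i) q = \sum_(i <- r) poly_at (F i) q.
Proof.
exact: (big_morph _ (fun P Q => poly_atD P Q q) (poly_at0 q)).
Qed.

(** Evaluation is not multiplicative, but it respects constants on the right, since coefficients
    stand to the right of the powers of [q]. *)
Lemma poly_atMC P c q : poly_at (P * c%:P) q = poly_at P q * c.
Proof.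
rewrite (@poly_at_widen _ _ (size P)); last first.
  apply/leq_sizeP => j Pj; rewrite coefMC nth_default ?mul0r//.
by rewrite mulr_suml; apply: eq_bigr => i _; rewrite coefMC mulrA.
Qed.

(** The factor [q] produced by the shift of coefficients comes out on the left, unlike a constant;
    this asymmetry gives the recursion [regular_powS]. *)
Lemma poly_atMX P q : poly_at (P * 'X) q = q * poly_at P q.
Proof.
rewrite (@poly_at_widen _ _ (size P).+1); last first.
  by apply/leq_sizeP => -[//|j] Pj; rewrite coefMX/= nth_default.
rewrite big_ord_recl coefMX mulr0 add0r mulr_sumr.
by apply: eq_bigr => i _; rewrite coefMX exprS mulrA.
Qed.

Lemma poly_atXn n q : poly_at 'X^n q = q ^+ n.
Proof.
by elim: n => [|n IHn]; rewrite ?expr0 ?poly_at1// exprSr poly_atMX IHn exprS.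
Qed.

Lemma regular_pow0 p q : regular_pow p 0 q = 1.
Proof. exact: poly_at1. Qed.

Lemma regular_powS p n q :
  regular_pow p n.+1 q = q * regular_pow p n q - regular_pow p n q * p.
Proof.
rewrite /regular_pow exprSr mulrBr poly_atD.
by rewrite poly_atN poly_atMX poly_atMC.
Qed.

Lemma regular_pow_norm_le p n q : `|regular_pow p n q| <= quat_sigma q p ^+ n.
Proof.
rewrite /quat_sigma; case: asboolP => [/common_line_comm qp|_].
  suff -> : regular_pow p n q = (q - p) ^+ n by rewrite quat_normX.
  elim: n => [|n IHn]; first by rewrite regular_pow0.
  rewrite regular_powS IHn exprS mulrBl; congr (_ - _); apply: commr_sym.
  by apply: commrX; apply: commrB.
elim: n => [|n IHn]; first by rewrite regular_pow0 quat_norm1.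
rewrite regular_powS exprS (le_trans (quat_norm_commutator_le _ _ _))//.
by rewrite ler_wpM2l ?sqrtr_ge0.
Qed.

Lemma expr_regular_pow p q m : q ^+ m =
  \sum_(n < m.+1) (regular_pow p n q * p ^+ (m - n)) *+ 'C(m, n).
Proof.
have pXp : GRing.comm p%:P ('X - p%:P).
  by apply: commrB => //; apply: commr_polyX.
rewrite -poly_atXn -{1}(subrK p%:P 'X) addrC exprDn_comm// poly_at_sum.
apply: eq_bigr => i _; rewrite poly_atMn; congr (_ *+ _).
(* [poly_atMC] extracts constants only on the right, so [p ^+ (m - i)] is first moved past the power
   of ['X - p%:P]. *)
have /(commrX i)/commr_sym/(commrX (m - i)) := pXp.
by move/commr_sym; rewrite /GRing.comm => ->; rewrite -rmorphXn poly_atMC.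
Qed.

End RegularPowers.

(** * Convergence of quaternionic sequences and series *)

Section Convergence.
Variable R : realType.
Implicit Types (c l p q : quat R) (u a : (quat R)^nat).

Lemma cvg_quatMl c u l : u @ \oo --> l -> (fun n => c * u n) @ \oo --> c * l.
Proof.
move=> ul; apply/cvgrPdist_le => e e0.
(* Adding 1 keeps the Lipschitz constant invertible when [c = 0]. *)
have c1 : 0 < `|c| + 1 by rewrite ltr_wpDl.
near=> n; rewrite -mulrBr quat_normM.
rewrite (@le_trans _ _ ((`|c| + 1) * `|l - u n|))// ?ler_wpM2r ?lerDl//.
rewrite -ler_pdivlMl//; near: n.
by move/cvgrPdist_le: ul; apply; rewrite mulr_gt0 ?invr_gt0.
Unshelve. all: by end_near. Qed.

(** Each coordinate is additive and bounded by the norm, so its series converges absolutely in [R];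
    the four limits recombine along the basis 1, i, j, k. *)
Lemma normed_quat_series_cvg u :
  cvgn [normed series u] -> cvgn (series u).
Proof.
move=> uc.
have coord (f : quat R -> R) : {morph f : x y / x + y} -> f 0 = 0 ->
    (forall x, `|f x| <= `|x|) -> cvgn (fun n => f (series u n)).
  move=> fD f0 fle; rewrite (_ : (fun n => _) = series (fun n => f (u n))).
    by apply: normed_cvg; apply: series_le_cvg uc => n /=.
  by apply/funext => n; rewrite /series /= (big_morph f fD f0).
have sqr_le (s x : R) : 0 <= s -> x ^+ 2 <= s -> `|x| <= Num.sqrt s.
  by move=> s0 xs; rewrite -sqrtr_sqr ler_wsqrtr.
have c0 : cvgn (fun n => quat0 (series u n)).
  apply: coord => // x; apply: sqr_le; rewrite ?quat_sqnorm_ge0//.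
  by rewrite /quat_sqnorm -!addrA lerDl !addr_ge0 ?sqr_ge0.
have c1 : cvgn (fun n => quat1 (series u n)).
  apply: coord => // x; apply: sqr_le; rewrite ?quat_sqnorm_ge0//.
  rewrite /quat_sqnorm (addrC (quat0 x ^+ 2)) -!addrA lerDl.
  by rewrite !addr_ge0 ?sqr_ge0.
have c2 : cvgn (fun n => quat2 (series u n)).
  apply: coord => // x; apply: sqr_le; rewrite ?quat_sqnorm_ge0//.
  by rewrite /quat_sqnorm -addrA addrCA lerDl !addr_ge0 ?sqr_ge0.
have c3 : cvgn (fun n => quat3 (series u n)).
  apply: coord => // x; apply: sqr_le; rewrite ?quat_sqnorm_ge0//.
  by rewrite /quat_sqnorm lerDr !addr_ge0 ?sqr_ge0.
rewrite (_ : series u = (fun n => quat0 (series u n) *: Quat 1 0 0 0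
    + quat1 (series u n) *: Quat 0 1 0 0 + quat2 (series u n) *: Quat 0 0 1 0
    + quat3 (series u n) *: Quat 0 0 0 1)); last first.
  apply/funext => n.
  by apply: quat_eq; rewrite /= !(mulr0, mulr1, addr0, add0r).
exact: (cvgP _ (cvgD (cvgD (cvgD (cvgZr_tmp c0) (cvgZr_tmp c1))
  (cvgZr_tmp c2)) (cvgZr_tmp c3))).
Qed.
End Convergence.

(** * Radius of convergence and coefficients of derivatives *)

Lemma conv_radius_ge0 (R : realType) (a : (quat R)^nat) :
  (0 <= conv_radius a)%E.
Proof.
rewrite inve_ge0; apply: le_ereal_inf_tmp => _ [A [n _ nA] <-].
apply: le_trans (ereal_sup_ubound _); last by exists n => //; apply: nA => /=.
by rewrite lee_fin powR_ge0.
Qed.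

(** Root test: for [s] strictly between [r] and the radius, the n-th root of [|a n|] is eventually
    at most [1 / s], so [(r / s) ^+ n] dominates. *)
Lemma conv_radius_normed_cvg (R : realType) (a : (quat R)^nat) (r : R) :
  0 <= r ->
  (r%:E < conv_radius a)%E -> cvgn (series (fun n => `|a n| * r ^+ n)).
Proof.
move=> r0 /lte_dense_fin[s rs sa].
have s0 : 0 < s by apply: le_lt_trans rs.
have /ereal_inf_lt[_ [A [N _ NA] <-] Asup] :
    (limn_esup (fun n => (`|a n| `^ n%:R^-1)%:E) < (s^-1)%:E)%E.
  have := sa; rewrite inve_pgt ?inE/= ?lee_fin ?(ltW s0)//.
    by rewrite inver gt_eqF.
  by rewrite -inve_ge0 conv_radius_ge0.
(* Starting at [N.+1] rather than [N] excludes index 0, where [n%:R^-1] is 0 by convention and the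
   root does not determine [|a n|]. *)
rewrite -(is_cvg_series_restrict N.+1).
rewrite (_ : [sequence _]_n =
  series (fun n => if (N < n)%N then `|a n| * r ^+ n else 0)).
  apply: (@series_le_cvg _ _ (geometric 1 (r / s))).
  - by move=> n; case: ifP => // _; rewrite mulr_ge0 ?exprn_ge0.
  - by move=> n; rewrite /= mul1r exprn_ge0// divr_ge0 ?(ltW s0).
  - move=> n; case: ifP => [Nn|_]; last first.
      by rewrite /= mul1r exprn_ge0// divr_ge0 ?(ltW s0).
    rewrite /= mul1r expr_div_n mulrC ler_wpM2l ?exprn_ge0//.
    have : `|a n| `^ n%:R^-1 <= s^-1.
      rewrite -lee_fin; apply: le_trans (ltW Asup).
      by apply: ereal_sup_ubound; exists n => //; apply: NA => /=; apply: ltnW.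
    move=> /(lerXn2r n); rewrite !nnegrE powR_ge0 invr_ge0 (ltW s0).
    move=> /(_ isT isT); rewrite exprVn -powR_mulrn ?powR_ge0// -powRrM.
    by rewrite mulVf ?powRr1// pnatr_eq0 -lt0n (leq_ltn_trans _ Nn).
  apply: is_cvg_geometric_series.
  by rewrite ger0_norm ?divr_ge0 ?(ltW s0)// ltr_pdivrMr// mul1r.
by apply/funext => n; rewrite /series /= (big_nat_widenl _ 0)// big_mkcond.
Qed.

Lemma iter_dcoefE (R : realType) (a : (quat R)^nat) n k :
  iter n (@dcoef R) a k = a (k + n)%N *+ ((k + n) ^_ n).
Proof.
elim: n k => [|n IHn] k; first by rewrite addn0 ffactn0 mulr1n.
by rewrite iterS /dcoef IHn addSnnS -mulrnA; congr (_ *+ _);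
  rewrite ffactnSr addnS subSn ?leq_addl// addnK.
Qed.

(** * Exchange of summation in a triangular double family *)

Section TriangularExchange.
Variables (R : realType) (b : nat -> nat -> quat R) (c : R^nat).
Hypothesis b_trig : forall m n, (m < n)%N -> b m n = 0.
Hypothesis b_le : forall m, \sum_(0 <= n < m.+1) `|b m n| <= c m.
Hypothesis c_cvg : cvgn (series c).

Let c_ge0 m : 0 <= c m.
Proof. by apply: le_trans (b_le m); apply: sumr_ge0. Qed.

Let rowsum_le m : `|\sum_(0 <= n < m.+1) b m n| <= c m.
Proof. exact: le_trans (ler_norm_sum _ _ _) (b_le m). Qed.

Lemma rowsum_series_cvg : cvgn (series (fun m => \sum_(0 <= n < m.+1) b m n)).
Proof.
by apply: normed_quat_series_cvg; apply: series_le_cvg c_cvg => m /=.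
Qed.

(** A row [m < N] lies entirely in the first [N] columns and leaves no error; in any other row the
    remainder is part of the absolute row sum. *)
Let row_tail_le m N :
  `|\sum_(0 <= n < m.+1) b m n - \sum_(0 <= n < N) b m n| <=
  if (N <= m)%N then c m else 0.
Proof.
case: leqP => [Nm|mN].
  rewrite (@big_cat_nat _ _ _ N 0 m.+1)//= ?leqW// addrC addrK.
  apply: le_trans (ler_norm_sum _ _ _) _; apply: le_trans (b_le m).
  by rewrite [leRHS](@big_cat_nat _ _ _ N 0 m.+1)//= ?leqW// lerDr sumr_ge0.
rewrite (@big_cat_nat _ _ _ m.+1 0 N)//= opprD addNKr.
by rewrite big_nat big1 ?oppr0 ?normr0// => n /andP[mn _]; rewrite b_trig.
Qed.

(* The error after [N] columns is controlled by the rows of index at least [N]. *)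
Lemma colsum_series_cvg (L : (quat R)^nat) :
  (forall n, series (b^~ n) @ \oo --> L n) ->
  series L @ \oo --> limn (series (fun m => \sum_(0 <= n < m.+1) b m n)).
Proof.
move=> bL; set f := limn _.
(* For fixed [N], the first [M] rows are compared with their truncation to [N] columns; the bound
   does not depend on [M], which then tends to infinity. *)
have tail N : `|f - series L N| <= limn (series c) - series c N.
  have colL :
      (fun M => \sum_(0 <= n < N) series (b^~ n) M) @ \oo --> series L N.
    apply: cvg_big => [|n _]; last exact: bL.
    exact: add_continuous.
  apply: (cvgr_to_le (cvg_norm (cvgB rowsum_series_cvg colL))).
  near=> M; have NM : (N <= M)%N by near: M; exact: nbhs_infty_ge.
  rewrite [X in `|X|](_ : _ = \sum_(0 <= m < M)
      (\sum_(0 <= n < m.+1) b m n - \sum_(0 <= n < N) b m n)); last first.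
    by rewrite sumrB [in RHS]exchange_big.
  apply: le_trans (ler_norm_sum _ _ _) _.
  apply: le_trans (ler_sum _ (fun m _ => row_tail_le m N)) _.
  have <- : \sum_(N <= m < M) c m =
      \sum_(0 <= m < M) if (N <= m)%N then c m else 0.
    by rewrite (big_nat_widenl _ 0)// big_mkcond.
  rewrite lerBrDl.
  have -> : series c N + \sum_(N <= m < M) c m = series c M.
    by rewrite /series /= -big_cat_nat.
  apply: nondecreasing_cvgn_le => //; apply/nondecreasing_seqP => k.
  by rewrite /series /= big_nat_recr//= lerDl.
apply/cvgrPdist_le => e e0; near=> N; apply: le_trans (tail N) _.
apply: le_trans (ler_norm _) _; near: N.
by move/cvgrPdist_le: c_cvg; apply.
Unshelve. all: by end_near. Qed.

End TriangularExchange.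

(** * Taylor coefficients as column sums *)

Lemma bin_term_le (R : realType) (s t : R) (m n : nat) : 0 <= s -> 0 <= t ->
  s ^+ n * t ^+ (m - n) *+ 'C(m, n) <= (s + t) ^+ m.
Proof.
move=> s0 t0; have [mn|nm] := ltnP m n.
  by rewrite bin_small// mulr0n exprn_ge0// addr_ge0.
have nm1 : (n < m.+1)%N by [].
rewrite addrC exprDn (bigD1 (Ordinal nm1))//= mulrC lerDl.
by apply: sumr_ge0 => i _; rewrite mulrn_wge0// mulr_ge0 ?exprn_ge0.
Qed.

Section Taylor.
Variables (R : realType) (a : (quat R)^nat) (p : quat R).
Hypothesis p_ball : (`|p|%:E < conv_radius a)%E.

(** ['C(m, n)] times n! is the falling factorial of [iter_dcoefE], so this is the series of the
    [n]-th derivative at [p], shifted by [n] and divided by n!. *)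
Lemma qpseries_deriv_cvg n :
  series (fun m => p ^+ (m - n) *+ 'C(m, n) * a m) @ \oo -->
  (n`!%:R : R)^-1 *: qpseries_deriv a n p.
Proof.
have [r pr ra] := lte_dense_fin p_ball.
have s0 : 0 < r - `|p| by rewrite subr_gt0.
set u := fun m => _.
have u_cvg : cvgn (series u).
  apply: normed_quat_series_cvg.
  (* The constant comes from [bin_term_le] with [s = r - |p|] and [t = |p|]: [|p|^(m - n) C(m, n)]
     is at most [(r - |p|)^(-n) r^m]. *)
  have /(@is_cvg_seriesZ _ _ ((r - `|p|) ^- n)) :=
    conv_radius_normed_cvg (le_trans (normr_ge0 _) (ltW pr)) ra.
  have k0 : 0 < (r - `|p|) ^- n by rewrite invr_gt0 exprn_gt0.
  apply: series_le_cvg => m /=; rewrite ?/GRing.scale/=.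
  - exact: normr_ge0.
  - by rewrite !mulr_ge0 ?exprn_ge0 ?(ltW k0)// (le_trans (normr_ge0 p))// ltW.
  - rewrite ler_pdivlMl ?exprn_gt0// quat_normM mulrA mulrC.
    rewrite ler_wpM2l// normrMn quat_normX mulrnAr.
    by have := bin_term_le m n (ltW s0) (normr_ge0 p); rewrite subrK.
have -> : qpseries_deriv a n p = n`!%:R *: limn (series u).
  apply: cvg_lim => //.
  (* The first [n] terms of [u] vanish with their binomial coefficients, so its partial sum at
     [k + n] matches that of the derivative at [k]. *)
  have : [sequence series u (k + n)]_k @ \oo --> limn (series u).
    by rewrite cvg_shiftn.
  move=> /(@cvgZl_tmp _ _ _ _ _ n`!%:R).
  apply: cvg_trans; apply: near_eq_cvg; near=> k => /=.
  rewrite /qpseries_at /series /= scaler_sumr.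
  rewrite (@big_cat_nat _ _ _ n 0 (k + n))//= ?leq_addl//.
  rewrite big_nat big1 ?add0r; last first.
    by move=> i /andP[_ i_n]; rewrite /u bin_small// mulr0n mul0r scaler0.
  rewrite -{1}[n]add0n big_addn addnK; apply: eq_bigr => i _.
  rewrite /u addnK iter_dcoefE -bin_ffact scaler_nat mulrnAl -mulrnA.
  by rewrite mulrnAr.
by rewrite scalerA mulVf ?scale1r// pnatr_eq0 -lt0n fact_gt0.
Unshelve. all: by end_near. Qed.

End Taylor.

Unset Implicit Arguments.

(** * Taylor expansion on the sigma-ball *)

Theorem theorem5p4 (R : realType) (a : (quat R)^nat) (p : quat R)
    (radius_gt0 : (0 < conv_radius a)%E) (p_ball : (`|p|%:E < conv_radius a)%E)
    (q : quat R) (q_Sigma : Sigma_ball p (conv_radius a - `|p|%:E)%E q) :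
  cvgn (qpseries_at a q) /\
  series (fun n => regular_pow p n q * ((n`!%:R : R)^-1 *: qpseries_deriv a n p))
    @ \oo --> qpseries a q.
Proof.
have [r sr ra] :
    exists2 r, quat_sigma q p + `|p| < r & (r%:E < conv_radius a)%E.
  by apply: lte_dense_fin; rewrite EFinD -lteBrDr.
have s0 := quat_sigma_ge0 q p.
have r0 : 0 <= r by rewrite ltW// (le_lt_trans _ sr)// addr_ge0.
(* The regular power is a left factor common to all of column [n], hence factors out of the column
   sum. *)
pose b m n := regular_pow p n q * (p ^+ (m - n) *+ 'C(m, n) * a m).
have bE m : q ^+ m * a m = \sum_(0 <= n < m.+1) b m n.
  rewrite (expr_regular_pow p) mulr_suml big_mkord; apply: eq_bigr => n _.
  by rewrite /b mulrA mulrnAr.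
have b_trig m n : (m < n)%N -> b m n = 0.
  by move=> mn; rewrite /b bin_small// mulr0n mul0r mulr0.
have b_le m : \sum_(0 <= n < m.+1) `|b m n| <= `|a m| * r ^+ m.
  (* The entries are compared one by one with the binomial terms of [(|p| + sigma)^m], times
     [|a m|]. *)
  rewrite mulrC (@le_trans _ _ ((`|p| + quat_sigma q p) ^+ m * `|a m|))//.
    rewrite exprDn mulr_suml big_mkord ler_sum// => n _.
    rewrite /b !quat_normM mulrA ler_wpM2r// normrMn quat_normX.
    rewrite mulrnAr lerMn2r mulrC ler_wpM2l ?orbT ?exprn_ge0//.
    exact: regular_pow_norm_le.
  by rewrite ler_wpM2r// lerXn2r ?nnegrE ?addr_ge0// addrC ltW.
have c_cvg := conv_radius_normed_cvg r0 ra.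
(* The row sums are the terms of the series at [q], so summing by rows gives its convergence and
   summing by columns the expansion. *)
rewrite /qpseries (_ : qpseries_at a q =
  series (fun m => \sum_(0 <= n < m.+1) b m n)); last first.
  by congr series; apply/funext.
split; first exact: rowsum_series_cvg b_le c_cvg.
apply: (colsum_series_cvg b_trig b_le c_cvg) => n.
rewrite (_ : series (b^~ n) = fun M => regular_pow p n q *
  series (fun m => p ^+ (m - n) *+ 'C(m, n) * a m) M); last first.
  by apply/funext => M; rewrite /series /= mulr_sumr.
exact/cvg_quatMl/qpseries_deriv_cvg.
Qed.
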